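(* Let $a$ be an odd integer. For $t\ge 5$, $$\#\bar{D}_2(a;2^t)=\begin{cases}\frac{2^{t-4}}{3}+\frac{(-1)^{t-1}}{3}+3 & a\equiv 7 \bmod 8,\\ 2^{t-3} & a\equiv 1,5 \bmod 8,\\ 2^{t-4} & a\equiv 3\bmod 8,\end{cases}\qquad \#\bar{S}_2(a;2^t)=\begin{cases}\frac{2^{t-4}}{3}+\frac{(-1)^{t-1}}{3}+3 & a\equiv 1 \bmod 8,\\ 2^{t-3} & a\equiv 3,7 \bmod 8,\\ 2^{t-4} & a\equiv 5\bmod 8.\end{cases}$$ Moreover, $\#\bar{S}_2(a;16)=2$ for all odd $a$, and for $1\le t\le 3$ we have $\#\bar{S}_2(a;2^t)=1$, except that $\#\bar{S}_2(a;8)=2$ when $a\equiv 1\bmod 4$.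
   Context: For $n\ge2$ and $a$ coprime to $n$, $H_2(a;n)=\{(x,y)\in\mathbb{Z}^2: xy\equiv a \bmod n,\ 1\le x,y<n\}$, $\bar{S}_2(a;n)=\{x+y \bmod n:(x,y)\in H_2(a;n)\}$ and $\bar{D}_2(a;n)=\{x-y \bmod n:(x,y)\in H_2(a;n)\}$, both subsets of $\mathbb{Z}/n\mathbb{Z}$. *)

(* Defs.v *)
From HB Require Import structures.
From mathcomp Require Import all_boot all_order all_algebra.

Set Implicit Arguments.
Unset Strict Implicit.
Unset Printing Implicit Defensive.

Import Order.TTheory GRing.Theory Num.Theory.
Local Open Scope ring_scope.

(* The integers x, y with 1 <= x, y < n are represented by the nonzero elements
   of 'I_n; the congruence is between integers. *)
Definition H2 (a : int) (n : nat) : {set 'I_n * 'I_n} :=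
  [set p : 'I_n * 'I_n | [&& (1 <= p.1)%N, (1 <= p.2)%N &
            ((p.1 : nat)%:Z * (p.2 : nat)%:Z == a %[mod n%:Z])%Z]].

(* 'Z_n is Z/nZ for n >= 2 only, and m%:~R : 'Z_n is the class of m : int. *)
Definition S2bar (a : int) (n : nat) : {set 'Z_n} :=
  [set ((p.1 : nat)%:Z + (p.2 : nat)%:Z)%:~R | p : 'I_n * 'I_n in H2 a n].

Definition D2bar (a : int) (n : nat) : {set 'Z_n} :=
  [set ((p.1 : nat)%:Z - (p.2 : nat)%:Z)%:~R | p : 'I_n * 'I_n in H2 a n].

(* Main.v *)
Require Import Defs.
From HB Require Import structures.
From mathcomp Require Import all_boot all_order all_algebra.
From mathcomp Require Import ring lra zify.
Set Implicit Arguments.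
Unset Strict Implicit.
Import Order.TTheory GRing.Theory Num.Theory.
Local Open Scope ring_scope.

(* Replacing y by -y turns differences into sums, so D(a) = S(-a).  A sum s = x + y
   with xy = a is even, and s = 2u occurs iff u^2 - a = (x - u)^2 is a square
   mod 2^t; hence #S(a; 2^t) counts the u mod 2^(t-1) with u^2 - a a square.
   An odd number is a square mod 2^k, k >= 3, iff it is 1 mod 8, which settles
   a = 3 mod 4 (u even) and a = 5 mod 8 (u odd, u^2 - a = 4 * odd).
   For a = 1 mod 8 write a = b^2.  Then u = b + 8p up to the sign of b, and
   u^2 - a = 16 p (b + 4p), so p (b + 4p), equivalently w = p / (b + 4p), must be
   a square mod 2^(t-4).  As p |-> w is a bijection mod 2^(t-4), the count is
   twice the number q(t-4) of squares mod 2^(t-4), where splitting into odd and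
   even squares gives q(k+3) = q(k+1) + 2^k. *)

(** * Congruence of integers modulo powers of two *)

Definition eqm (k : nat) (x y : int) : bool := (2 ^+ k %| x - y)%Z.

Lemma eqmP k x y : reflect (exists e, x = y + e * 2 ^+ k) (eqm k x y).
Proof.
apply: (iffP dvdzP) => -[e he]; exists e; first by rewrite -he; ring.
by rewrite he; ring.
Qed.

Lemma eqm_sym k x y : eqm k x y -> eqm k y x.
Proof. by case/eqmP=> e ->; apply/eqmP; exists (- e); ring. Qed.

Lemma eqm_trans k y x z : eqm k x y -> eqm k y z -> eqm k x z.
Proof.
by case/eqmP=> e -> /eqmP[f ->]; apply/eqmP; exists (f + e); ring.
Qed.

Lemma eqm_le j k x y : (j <= k)%N -> eqm k x y -> eqm j x y.
Proof. by move=> jk; apply: dvdz_trans; apply: dvdz_exp2l. Qed.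

Lemma eqm3 x y : eqm 3 x y = (8 %| x - y)%Z. Proof. by []. Qed.

Lemma eqm5 x y : eqm 5 x y = (32 %| x - y)%Z. Proof. by []. Qed.

Lemma eqm_repr k x : exists2 i : nat, (i < 2 ^ k)%N & eqm k x i%:Z.
Proof.
have h : (0 : int) < 2 ^+ k by rewrite exprn_gt0.
exists `|(x %% 2 ^+ k)%Z|%N.
  rewrite -ltz_nat gez0_abs ?modz_ge0 ?gt_eqF //.
  have := ltz_mod x (lt0r_neq0 h).
  by rewrite (gtr0_norm h) -natz natrX.
rewrite gez0_abs ?modz_ge0 ?gt_eqF //.
apply/eqmP; exists (x %/ 2 ^+ k)%Z.
by rewrite {1}(divz_eq x (2 ^+ k)); ring.
Qed.

Lemma eqm_small k (i j : nat) :
  (i < 2 ^ k)%N -> (j < 2 ^ k)%N -> eqm k i%:Z j%:Z -> i = j.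
Proof.
move=> hi hj.
rewrite /eqm (_ : 2 ^+ k = (2 ^ k)%N%:Z :> int); last by rewrite -natz natrX.
by rewrite -eqz_mod_dvd !modz_nat eqz_nat !modn_small // => /eqP.
Qed.

(** * Parity, squares modulo 4 and 8, and inverses of odd integers *)

Lemma odd_intP (z : int) : ~~ (2 %| z)%Z -> exists g, z = 2 * g + 1.
Proof. by move=> h; exists (z %/ 2)%Z; lia. Qed.

Lemma even_intP (z : int) : (2 %| z)%Z -> exists g, z = 2 * g.
Proof. by move=> h; exists (z %/ 2)%Z; lia. Qed.

Lemma sqr_odd_mod8 (z : int) : ~~ (2 %| z)%Z -> (8 %| z * z - 1)%Z.
Proof.
case/odd_intP=> g ->; apply/dvdzP.
have [/even_intP[h ->]|/odd_intP[h ->]] := boolP (2 %| g)%Z.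
  by exists (h * (2 * h + 1)); ring.
by exists ((2 * h + 1) * (h + 1)); ring.
Qed.

Lemma sqr_even_mod4 (z : int) : (2 %| z)%Z -> (4 %| z * z)%Z.
Proof. by case/even_intP=> g ->; apply/dvdzP; exists (g * g); ring. Qed.

(** Hensel lifting: if the error [e] of an inverse modulo [2 ^+ k] is odd, adding [2 ^+ k] to [y]
    turns it into [e + x], which is even. *)
Lemma odd_inverse k x : ~~ (2 %| x)%Z -> exists y, eqm k (x * y) 1.
Proof.
move=> hx; elim: k => [|k [y /eqmP[e he]]]; first by exists 1; rewrite /eqm expr0 dvd1z.
have [/even_intP[f hf]|ho] := boolP (2 %| e)%Z.
  by exists y; apply/eqmP; exists f; rewrite he hf exprS; ring.
have [f hf] : exists f, e + x = 2 * f by apply: even_intP; lia.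
exists (y + 2 ^+ k); apply/eqmP; exists f.
by rewrite mulrDr he exprS -addrA -mulrDl hf; ring.
Qed.

Lemma eqm_cancel k x y z : ~~ (2 %| x)%Z -> eqm k (x * y) (x * z) -> eqm k y z.
Proof.
move=> /(odd_inverse k)[i /eqmP[e he]] /eqmP[f hf].
apply/eqmP; exists (i * f + (z - y) * e).
have : i * (x * y) = i * (x * z + f * 2 ^+ k) by rewrite hf.
have -> : i * (x * y) = (x * i) * y by ring.
have -> : i * (x * z + f * 2 ^+ k) = (x * i) * z + i * f * 2 ^+ k by ring.
rewrite he => h.
rewrite [LHS](_ : _ = (1 + e * 2 ^+ k) * y - e * y * 2 ^+ k); last by ring.
by rewrite h; ring.
Qed.

(** * Squares modulo powers of two *)

(** A finite search through a list of residues, so that counts of squares for small exponents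
    evaluate by computation. *)
Definition sq (k : nat) (c : int) : bool :=
  has (fun z : nat => eqm k (z%:Z * z%:Z) c) (iota 0 (2 ^ k)).

Lemma sqP k c : reflect (exists z, eqm k (z * z) c) (sq k c).
Proof.
apply: (iffP hasP) => [[z _ hz]|[z hz]]; first by exists z%:Z.
have [i hi /eqmP[e he]] := eqm_repr k z.
exists i; first by rewrite mem_iota.
apply: eqm_trans hz; apply/eqmP; exists (- e * (i%:Z + z)).
by rewrite he; ring.
Qed.

Lemma sq_eqm k c d : eqm k c d -> sq k c -> sq k d.
Proof.
by move=> cd /sqP[z hz]; apply/sqP; exists z; apply: eqm_trans hz cd.
Qed.

Lemma sq_eqmE k c d : eqm k c d -> sq k c = sq k d.
Proof. by move=> cd; apply/idP/idP; apply: sq_eqm => //; apply: eqm_sym. Qed.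

(** Hensel lifting of an odd root [z], started modulo 8: adding [2 ^+ (k + 2)] changes [z * z] by
    [z * 2 ^+ (k + 3)] plus a multiple of [2 ^+ (k + 4)], which flips the parity of the error. Small
    moduli follow by weakening. *)
Lemma sq_one_mod8 k c : (8 %| c - 1)%Z -> sq k c.
Proof.
move=> hc; suff [z _ hz] : exists2 z, ~~ (2 %| z)%Z & eqm (k + 3) (z * z) c.
  by apply/sqP; exists z; apply: eqm_le hz; apply: leq_addr.
elim: k => [|k [z hz /eqmP[e he]]].
  by exists 1 => //; apply: eqm_sym.
have [/even_intP[f hf]|/odd_intP[f hf]] := boolP (2 %| e)%Z.
  by exists z => //; apply/eqmP; exists f; rewrite he hf addSn exprS; ring.
have [g hg] := odd_intP hz.
exists (z + 2 ^+ (k + 2)); first by rewrite addnC exprS; lia.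
apply/eqmP; exists (f + g + 1 + 2 ^+ k).
have -> : (z + 2 ^+ (k + 2)) * (z + 2 ^+ (k + 2)) =
  z * z + z * 2 ^+ (k + 3) + 2 ^+ (k + 2) * 2 ^+ (k + 2).
  by rewrite !addnS addn0 !exprS; ring.
by rewrite he hf hg !addSn !addnS addn0 !exprS; ring.
Qed.

Lemma sq_odd k c : ~~ (2 %| c)%Z -> sq k.+3 c = (8 %| c - 1)%Z.
Proof.
move=> hc; apply/idP/idP; last exact: sq_one_mod8.
case/sqP=> z /eqmP[e]; rewrite !exprS.
have [/sqr_even_mod4|/sqr_odd_mod8] := boolP (2 %| z)%Z; lia.
Qed.

(** A root of [4 * c] modulo [2 ^+ k.+2] is even, because odd squares are 1 mod 8; halving it gives
    a root of [c]. *)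
Lemma sq_mul4 k c : sq k.+2 (4 * c) = sq k c.
Proof.
apply/idP/idP => /sqP[z /eqmP[e]]; rewrite ?exprS => he.
  have [/even_intP[g hg]|/sqr_odd_mod8] := boolP (2 %| z)%Z; last by lia.
  by apply/sqP; exists g; apply/eqmP; exists e; move: he; rewrite hg; lia.
apply/sqP; exists (2 * z); apply/eqmP; exists e; rewrite !exprS.
have -> : 2 * z * (2 * z) = 4 * (z * z) by ring.
by rewrite he; ring.
Qed.

Lemma sq_mod4 k c : sq k.+2 c -> (4 %| c)%Z || (4 %| c - 1)%Z.
Proof.
case/sqP=> z /eqmP[e]; rewrite !exprS.
have [/sqr_even_mod4|/sqr_odd_mod8] := boolP (2 %| z)%Z; lia.
Qed.

(** * Counting residue classes *)

Definition cnt (k : nat) (P : pred int) : nat :=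
  count (fun i : nat => P i%:Z) (iota 0 (2 ^ k)).

Lemma eq_cnt k P Q : P =1 Q -> cnt k P = cnt k Q.
Proof. by move=> PQ; apply: eq_count => i; apply: PQ. Qed.

Lemma cnt_split k (A P : pred int) :
  cnt k P = (cnt k [pred x | P x && A x] + cnt k [pred x | P x && ~~ A x])%N.
Proof.
rewrite /cnt -count_predUI [X in (_ + X)%N](eq_count (a2 := pred0)).
  by rewrite count_pred0 addn0; apply: eq_count => i /=; case: (P _); case: (A _).
by move=> i /=; case: (P _); case: (A _).
Qed.

Lemma cntE k P : cnt k P = #|[set i : 'I_(2 ^ k) | P (i : nat)%:Z]|.
Proof.
have := sum1_count (index_iota 0 (2 ^ k)) (fun i : nat => P i%:Z).
by rewrite big_mkord sum1dep_card /index_iota subn0 => ->.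
Qed.

(** The relation [R] stands for an injection of residue classes. It need only be given up to
    congruence; the reduction to representatives is done here once and for all. *)
Lemma cnt_le k l (P Q : pred int) (R : int -> int -> Prop) :
    (forall x y, eqm l x y -> Q x -> Q y) ->
    (forall x, P x -> exists2 y, Q y & R x y) ->
    (forall x x' y y', R x y -> R x' y' -> eqm l y y' -> eqm k x x') ->
  (cnt k P <= cnt l Q)%N.
Proof.
move=> Qper tot inj; rewrite !cntE.
(* A default value for the residues outside [P]. *)
have i0 : 'I_(2 ^ l) by exists 0%N; rewrite expn_gt0.
have [f hf] : exists f : 'I_(2 ^ k) -> 'I_(2 ^ l), forall i : 'I_(2 ^ k),
    P (i : nat)%:Z -> Q (f i : nat)%:Z /\
      exists2 y, R (i : nat)%:Z y & eqm l y (f i : nat)%:Z.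
  apply: (fin_all_exists (P := fun i : 'I_(2 ^ k) => fun j : 'I_(2 ^ l) =>
    P (i : nat)%:Z -> Q (j : nat)%:Z /\
      exists2 y, R (i : nat)%:Z y & eqm l y (j : nat)%:Z)) => i.
  have [Pi|_] := boolP (P (i : nat)%:Z); last by exists i0.
  have [y Qy Ry] := tot _ Pi; have [j hj yj] := eqm_repr l y.
  exists (Ordinal hj) => _; split; first exact: Qper Qy.
  by exists y.
rewrite -(card_in_imset (f := f)).
  apply/subset_leq_card/subsetP => j /imsetP[i]; rewrite !inE => Pi ->.
  by have [] := hf i Pi.
move=> i j; rewrite !inE => /hf[_ [y Ry ey]] /hf[_ [z Rz ez]] ij.
apply/val_inj/(eqm_small (ltn_ord i) (ltn_ord j)); apply: (inj _ _ _ _ Ry Rz).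
by apply: eqm_trans ey _; rewrite ij; apply: eqm_sym.
Qed.

Lemma cnt_eq k l (P Q : pred int) (R : int -> int -> Prop) :
    (forall x y, eqm k x y -> P x -> P y) ->
    (forall x y, eqm l x y -> Q x -> Q y) ->
    (forall x, P x -> exists2 y, Q y & R x y) ->
    (forall y, Q y -> exists2 x, P x & R x y) ->
    (forall x x' y y', R x y -> R x' y' -> eqm k x x' = eqm l y y') ->
  cnt k P = cnt l Q.
Proof.
move=> Pper Qper tot tot' eqR; apply/eqP; rewrite eqn_leq; apply/andP; split.
  by apply: (@cnt_le _ _ _ _ R) => // x x' y y' r r'; rewrite (eqR _ _ _ _ r r').
apply: (@cnt_le _ _ _ _ (fun y x => R x y)) => // y y' x x' r r'.
by rewrite (eqR _ _ _ _ r r').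
Qed.

(** Each step of the induction cuts the range into two halves that differ by the shift
    [2 ^ (k + d)], a multiple of the period. *)
Lemma cnt_periodic k d (P : pred int) :
  (forall x y, eqm d x y -> P x -> P y) -> cnt (k + d) P = (2 ^ k * cnt d P)%N.
Proof.
move=> Pper; elim: k => [|k IHk]; first by rewrite mul1n.
rewrite {1}/cnt addSn expnS mul2n -addnn iotaD count_cat -/(cnt _ _) add0n.
rewrite -[X in iota X _]addn0 iotaDl count_map.
rewrite [X in (_ + X)%N](_ : _ = cnt (k + d) P).
  by rewrite IHk addnn -mul2n expnS mulnA.
apply: eq_count => i /=.
have h : eqm d (2 ^ (k + d) + i)%N%:Z i%:Z.
  apply/eqmP; exists (2 ^+ k).
  by rewrite PoszD -exprD -[(2 ^ _)%N%:Z]natz natrX addrC.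
by apply/idP/idP; apply: Pper => //; apply: eqm_sym.
Qed.

(** * The number of squares modulo a power of two *)

(** The even squares are the [4 * v] with [v] a square modulo [2 ^+ k.+1]; the odd ones are the
    [2 ^ k] classes that are 1 mod 8. *)
Lemma cnt_sq_rec k : cnt k.+3 (sq k.+3) = (cnt k.+1 (sq k.+1) + 2 ^ k)%N.
Proof.
rewrite (cnt_split _ (fun w => (2 %| w)%Z)); congr (_ + _)%N.
  apply: (@cnt_eq _ _ _ _ (fun w v => w = 4 * v)) => /=.
  - move=> x y xy /andP[/(sq_eqm xy)-> ev] /=.
    by case/eqmP: xy ev => e ->; rewrite exprS; lia.
  - by move=> x y; apply: sq_eqm.
  - move=> w /andP[sw ew].
    have [v hv] : exists v, w = 4 * v.
      by exists (w %/ 4)%Z; have := sq_mod4 sw; lia.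
    by exists v => //; rewrite -sq_mul4 -hv.
  - move=> v sv; exists (4 * v) => //; rewrite sq_mul4 sv; lia.
  - move=> _ _ v v' -> ->; apply/eqmP/eqmP => -[e he]; exists e;
    by move: he; rewrite !exprS; lia.
rewrite (@eq_cnt _ _ (fun w => eqm 3 w 1)).
  rewrite -addn3 cnt_periodic ?muln1 // => x y xy; apply: eqm_trans.
  exact: eqm_sym.
move=> w /=; have [ew|ow] := boolP (2 %| w)%Z.
  by rewrite andbF eqm3; lia.
by rewrite andbT sq_odd.
Qed.

(** The recurrence advances by two, so the induction carries two consecutive values. Exponents start
    at 1: at exponent 0 the closed form would give 3/2 instead of 1. *)
Lemma cnt_sq k :
  6 * (cnt k.+1 (sq k.+1))%:R = 2 ^+ k.+1 - (-1) ^+ k.+1 + 9 :> rat.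
Proof.
suff: 6 * (cnt k.+1 (sq k.+1))%:R = 2 ^+ k.+1 - (-1) ^+ k.+1 + 9 :> rat /\
      6 * (cnt k.+2 (sq k.+2))%:R = 2 ^+ k.+2 - (-1) ^+ k.+2 + 9 :> rat by case.
elim: k => [|k [IH1 IH2]]; first by split; vm_compute.
split=> //; rewrite cnt_sq_rec natrD mulrDr IH1 natrX !exprS; ring.
Qed.

(** * Counting the [u] with [u * u - a] a square, by the class of [a] *)

(** The bijection sends [u = b + 8 * p] to [w = p / (b + 4 * p)], written without division as
    [p = w * (b + 4 * p)] modulo [2 ^+ k]. Since [p * (b + 4 * p) = w * (b + 4 * p) ^ 2] with
    [b + 4 * p] odd, one side is a square iff [w] is. *)
Lemma cnt_class k a b : ~~ (2 %| b)%Z -> eqm (k + 4) (b * b) a ->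
  cnt (k + 3) (fun u => sq (k + 4) (u * u - a) && eqm 3 u b) = cnt k (sq k).
Proof.
move=> ob /eqmP[e0 he0].
have sqE p : sq (k + 4) ((b + 8 * p) * (b + 8 * p) - a) = sq k (p * (b + 4 * p)).
  rewrite -[RHS]sq_mul4 -[RHS]sq_mul4 !addnS addn0; apply: sq_eqmE.
  apply/eqmP; exists e0.
  have -> : (b + 8 * p) * (b + 8 * p) = b * b + 16 * (p * (b + 4 * p)) by ring.
  by rewrite he0 !addnS addn0; ring.
have ob4 p : ~~ (2 %| b + 4 * p)%Z by lia.
have o14 w : ~~ (2 %| 1 - 4 * w)%Z by lia.
apply: (@cnt_eq _ _ _ _ (fun u w =>
  exists2 p, u = b + 8 * p & eqm k p (w * (b + 4 * p)))).
- move=> x y xy /andP[sx xb]; apply/andP; split.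
    apply: sq_eqm sx; case/eqmP: xy => e ->.
    apply/eqmP; exists (e * y + e * e * 2 ^+ k.+2).
    by rewrite !addnS addn0 !exprS; ring.
  by apply: eqm_trans xb; apply: eqm_sym; apply: eqm_le xy; rewrite leq_addl.
- by move=> x y; apply: sq_eqm.
- move=> u /andP[su /eqmP[p hp]].
  have {}hp : u = b + 8 * p by rewrite hp; ring.
  move: su; rewrite hp sqE => /sqP[z /eqmP[e he]].
  have [i /eqmP[f hf]] := odd_inverse k (ob4 p).
  (* As [i] inverts [b + 4 * p], this is the quotient [w]; it equals [p * (b + 4 * p)] times the
     square of [i], hence the root [z * i]. *)
  exists (p * i).
    apply/sqP; exists (z * i); apply/eqmP; exists (p * i * f + e * i * i).
    have -> : z * i * (z * i) = (z * z) * i * i by ring.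
    rewrite he.
    have -> : (p * (b + 4 * p) + e * 2 ^+ k) * i * i =
      p * i * ((b + 4 * p) * i) + e * i * i * 2 ^+ k by ring.
    by rewrite hf; ring.
  exists p => //; apply: eqm_sym; apply/eqmP; exists (p * f).
  have -> : p * i * (b + 4 * p) = p * ((b + 4 * p) * i) by ring.
  by rewrite hf; ring.
- move=> w /sqP[z /eqmP[e he]].
  have [i /eqmP[f hf]] := odd_inverse k (o14 w).
  (* Solving [p = w * (b + 4 * p)] for [p] gives [p * (1 - 4 * w) = w * b], and [i] inverts
     [1 - 4 * w]. *)
  pose p := w * b * i.
  have hp : eqm k p (w * (b + 4 * p)).
    apply/eqmP; exists (w * b * f).
    rewrite [LHS](_ : _ = p * (1 - 4 * w) + 4 * w * p); last by ring.
    rewrite [in X in X + _ = _]/p.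
    have -> : w * b * i * (1 - 4 * w) = w * b * ((1 - 4 * w) * i) by ring.
    rewrite hf; ring.
  exists (b + 8 * p); last by exists p.
  rewrite sqE; apply/andP; split; last by rewrite eqm3; lia.
  apply/sqP; exists (z * (b + 4 * p)).
  case/eqmP: hp => g hg; apply/eqmP.
  exists (e * (b + 4 * p) * (b + 4 * p) - g * (b + 4 * p)).
  have -> : p * (b + 4 * p) = (w * (b + 4 * p) + g * 2 ^+ k) * (b + 4 * p).
    by rewrite -hg.
  have -> : z * (b + 4 * p) * (z * (b + 4 * p)) = (z * z) * (b + 4 * p) * (b + 4 * p).
    by ring.
  by rewrite he; ring.
- move=> _ _ w w' [p -> hp] [p' -> hp'].
  have -> : eqm (k + 3) (b + 8 * p) (b + 8 * p') = eqm k p p'.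
    apply/eqmP/eqmP => -[e he]; exists e; move: he;
    by rewrite !addnS addn0 !exprS; lia.
  case/eqmP: hp => g hg; case/eqmP: hp' => g' hg'.
  (* From [p] to [w] the odd factor [b + 4 * p] is cancelled; from [w] to [p] the odd factor
     [1 - 4 * w]. *)
  apply/idP/idP => /eqmP[e he].
    apply: (@eqm_cancel _ (b + 4 * p)) => //.
    apply/eqmP; exists (e - g + g' - 4 * w' * e).
    have -> : (b + 4 * p) * w = p - g * 2 ^+ k by rewrite [in RHS]hg; ring.
    have -> : (b + 4 * p) * w' = w' * (b + 4 * p') + 4 * w' * (p - p') by ring.
    have -> : w' * (b + 4 * p') = p' - g' * 2 ^+ k by rewrite [in RHS]hg'; ring.
    by rewrite he; ring.
  apply: (@eqm_cancel _ (1 - 4 * w)) => //.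
  apply/eqmP; exists (g - g' + e * (b + 4 * p')).
  have -> : (1 - 4 * w) * p = w * b + g * 2 ^+ k.
    have -> : (1 - 4 * w) * p = p - 4 * w * p by ring.
    by rewrite [in X in X - _]hg; ring.
  have -> : (1 - 4 * w) * p' = w' * (b + 4 * p') + g' * 2 ^+ k - 4 * w * p'.
    by rewrite -hg'; ring.
  by rewrite he; ring.
Qed.

(** With [b] a root of [a], every counted [u] is [b] or [- b] modulo 8. These classes are distinct
    as [b] is odd, and [cnt_class] applies to both roots. *)
Lemma cnt_1mod8 k a : (8 %| a - 1)%Z ->
  cnt (k + 3) (fun u => sq (k + 4) (u * u - a)) = (2 * cnt k (sq k))%N.
Proof.
move=> ha.
have /sqP[b hb] := sq_one_mod8 (k + 4) ha.
have ob : ~~ (2 %| b)%Z.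
  case/eqmP: (hb) => e; rewrite !addnS exprS.
  by have [/sqr_even_mod4|] := boolP (2 %| b)%Z; lia.
have hb' : eqm (k + 4) (- b * - b) a by rewrite mulrNN.
have ob' : ~~ (2 %| - b)%Z by lia.
rewrite (cnt_split _ (fun u => eqm 3 u b)) mul2n -addnn.
congr (_ + _)%N; first exact: cnt_class.
rewrite -(cnt_class ob' hb'); apply: eq_cnt => u /=.
have [su|//] := boolP (sq _ _); rewrite /= !eqm3.
have [eu|ou] := boolP (2 %| u)%Z.
  by move: (sqr_even_mod4 eu); rewrite !addnS in su; have := sq_mod4 su; lia.
(* Both [u * u] and [a] are 1 mod 8, so 8 divides the square [z * z]; then 4 divides [z] and 16
   divides [z * z]. *)
have h16 : (16 %| (u - b) * (u + b))%Z.
  case/sqP: su => z /eqmP[e he]; case/eqmP: hb => f hf.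
  have h : z * z = (u - b) * (u + b) + (e + f) * 2 ^+ (k + 4).
    have -> : (u - b) * (u + b) = u * u - b * b by ring.
    by rewrite he hf; ring.
  have e4 : 2 ^+ (k + 4) = 16 * 2 ^+ k :> int by rewrite !addnS addn0 !exprS; ring.
  have [g hg] : exists g, z = 4 * g.
    have hz8 : (8 %| z * z)%Z.
      move: (sqr_odd_mod8 ou) ha; rewrite he e4; lia.
    have [/even_intP[y hy]|/sqr_odd_mod8] := boolP (2 %| z)%Z; last by lia.
    have [/even_intP[x hx]|/sqr_odd_mod8 oy] := boolP (2 %| y)%Z.
      by exists x; rewrite hy hx; ring.
    by move: hz8; rewrite hy; lia.
  apply/dvdzP; exists (g * g - (e + f) * 2 ^+ k).
  have -> : (u - b) * (u + b) = z * z - (e + f) * 2 ^+ (k + 4) by rewrite h; ring.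
  by rewrite e4 hg; ring.
have [r hr] := odd_intP ob; have [s hs] := odd_intP ou.
(* The factors [s - r] and [s + r + 1] have odd sum, so one is odd and 4 divides the other; doubled,
   that other one is [u - b] or [u + b]. *)
have h4 : (4 %| (s - r) * (s + r + 1))%Z.
  by move: h16; rewrite hr hs; lia.
have gauss x y : ~~ (2 %| x)%Z -> (4 %| x * y)%Z -> (4 %| y)%Z.
  move=> ox xy; suff: eqm 2 y 0 by rewrite /eqm subr0.
  by apply: (eqm_cancel ox); rewrite mulr0 /eqm subr0.
have [ev|od] := boolP (2 %| s - r)%Z.
  have := gauss (s + r + 1) (s - r); rewrite mulrC => /(_ _ h4); lia.
by have := gauss _ _ od h4; lia.
Qed.

(** For odd [u] the difference is 2 mod 4, never a square; for even [u] it is odd, so the condition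
    is [u * u = a + 1] modulo 8. This depends on [u] mod 4 and holds for one class: 2 if [a] is 3
    mod 8, 0 if [a] is 7 mod 8. *)
Lemma cnt_3mod4 k a : (4 %| a - 3)%Z ->
  cnt (k + 2) (fun u => sq k.+3 (u * u - a)) = (2 ^ k)%N.
Proof.
move=> ha.
have -> : cnt (k + 2) (fun u => sq k.+3 (u * u - a)) =
    cnt (k + 2) (fun u => eqm 3 (u * u) (a + 1)).
  apply: eq_cnt => u; rewrite eqm3.
  have [/sqr_even_mod4 eu|/sqr_odd_mod8 ou] := boolP (2 %| u)%Z.
    by rewrite sq_odd; lia.
  by apply/idP/idP => [/sq_mod4|]; lia.
rewrite cnt_periodic; last first.
  move=> x y /eqmP[e ->]; rewrite !eqm3; apply: contraLR.
  have -> : (y + e * 2 ^+ 2) * (y + e * 2 ^+ 2) = y * y + 8 * (e * y + 2 * e * e) by ring.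
  by lia.
have [h|h] : (8 %| a - 3)%Z \/ (8 %| a - 7)%Z by lia.
  rewrite (@eq_cnt _ _ (fun u => eqm 3 (u * u) 4)) ?muln1 // => u.
  by rewrite !eqm3; lia.
rewrite (@eq_cnt _ _ (fun u => eqm 3 (u * u) 0)) ?muln1 // => u.
by rewrite !eqm3; lia.
Qed.

(** For even [u] the difference is 3 mod 4, never a square; for odd [u] it is 4 times an odd number,
    which must be 1 mod 8, so the condition is [u * u = a + 4] modulo 32. This depends on [u] mod
    16, and each of 1, 9, 17, 25 has exactly two roots there. *)
Lemma cnt_5mod8 k a : (8 %| a - 5)%Z ->
  cnt (k + 4) (fun u => sq k.+4.+1 (u * u - a)) = (2 ^ k.+1)%N.
Proof.
move=> ha.
have -> : cnt (k + 4) (fun u => sq k.+4.+1 (u * u - a)) =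
    cnt (k + 4) (fun u => eqm 5 (u * u) (a + 4)).
  apply: eq_cnt => u; rewrite eqm5.
  have [/sqr_even_mod4 eu|/sqr_odd_mod8 ou] := boolP (2 %| u)%Z.
    by apply/idP/idP => [/sq_mod4|]; lia.
  have [c hc] : exists c, u * u - a = 4 * c.
    by exists ((u * u - a) %/ 4)%Z; lia.
  by rewrite hc sq_mul4 sq_odd; lia.
rewrite cnt_periodic; last first.
  move=> x y /eqmP[e ->]; rewrite !eqm5; apply: contraLR.
  have -> : (y + e * 2 ^+ 4) * (y + e * 2 ^+ 4) = y * y + 32 * (e * y + 8 * e * e) by ring.
  by lia.
rewrite expnSr; congr (_ * _)%N.
have [h|[h|[h|h]]] : (32 %| a + 4 - 1)%Z \/ (32 %| a + 4 - 9)%Z \/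
    (32 %| a + 4 - 17)%Z \/ (32 %| a + 4 - 25)%Z by lia.
- by rewrite (@eq_cnt _ _ (fun u => eqm 5 (u * u) 1)) // => u; rewrite !eqm5; lia.
- by rewrite (@eq_cnt _ _ (fun u => eqm 5 (u * u) 9)) // => u; rewrite !eqm5; lia.
- by rewrite (@eq_cnt _ _ (fun u => eqm 5 (u * u) 17)) // => u; rewrite !eqm5; lia.
- by rewrite (@eq_cnt _ _ (fun u => eqm 5 (u * u) 25)) // => u; rewrite !eqm5; lia.
Qed.

(** * From sum and difference sets to counts of residues *)

Lemma intr_Zp_eq n (x y : int) : (1 < n)%N ->
  (x%:~R == y%:~R :> 'Z_n) = (n%:Z %| x - y)%Z.
Proof.
move=> n1; have n0 : n%:R = 0 :> 'Z_n by rewrite pchar_Zp.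
rewrite -subr_eq0 -rmorphB /=; set z := x - y.
rewrite {1}(divz_eq z n%:Z) rmorphD rmorphM /= -pmulrn n0 mulr0 add0r.
have hz : (0 <= z %% n%:Z)%Z by apply: modz_ge0; lia.
rewrite -(gez0_abs hz) -pmulrn -val_eqE /= val_Zp_nat //.
rewrite modn_small.
  rewrite -eqz_nat gez0_abs //; exact: (sameP eqP dvdz_mod0P).
have : (z %% n%:Z < n%:Z)%Z by apply: ltz_pmod; lia.
lia.
Qed.

(** The reflection of [y] to [n - y] preserves the range from 1 to [n - 1] and negates the product
    modulo [n]. *)
Lemma H2_opp a n (x y : 'I_n) : (x, y) \in H2 a n ->
  exists2 z : 'I_n, (x, z) \in H2 (- a) n & (z : nat)%:Z = n%:Z - (y : nat)%:Z.
Proof.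
rewrite inE /= => /and3P[hx hy]; rewrite eqz_mod_dvd => /dvdzP[e he].
have hz : (n - y < n)%N by have := ltn_ord y; lia.
have zE : (n - y)%N%:Z = n%:Z - (y : nat)%:Z by rewrite subzn // ltnW.
exists (Ordinal hz) => //; rewrite inE /= hx /= zE eqz_mod_dvd.
apply/andP; split; first by have := ltn_ord y; lia.
apply/dvdzP; exists ((x : nat)%:Z - e).
by rewrite mulrBl -he; ring.
Qed.

Lemma D2bar_S2bar a n : (1 < n)%N -> D2bar a n = S2bar (- a) n.
Proof.
move=> n1; apply/setP => s; apply/imsetP/imsetP => -[[x y]] /H2_opp[z].
  move=> hz zE ->; exists (x, z) => //=; apply/eqP.
  by rewrite intr_Zp_eq // zE; apply/dvdzP; exists (- 1); ring.
rewrite opprK => hz zE ->; exists (x, z) => //=; apply/eqP.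
by rewrite intr_Zp_eq // zE; apply/dvdzP; exists 1; ring.
Qed.

(** The map from [u] mod [2 ^ t] to [2 * u] mod [2 ^ t.+1] is injective, and its image of the
    counted residues is the set of sums. *)
Lemma card_S2bar a t : ~~ (2 %| a)%Z ->
  #|S2bar a (2 ^ t.+1)| = cnt t (fun u => sq t.+1 (u * u - a)).
Proof.
move=> oa; set n := (2 ^ t.+1)%N.
have n1 : (1 < n)%N by rewrite /n expnS; have := expn_gt0 2 t; lia.
have nE : n%:Z = 2 ^+ t.+1 by rewrite /n -natz natrX.
have dvdE x y : (n%:Z %| x - y)%Z = eqm t.+1 x y by rewrite nE.
rewrite cntE.
pose f (u : 'I_(2 ^ t)) : 'Z_n := (2 * (u : nat)%:Z)%:~R.
rewrite -(card_in_imset (f := f)); last first.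
  move=> u v _ _ /eqP; rewrite intr_Zp_eq // dvdE => /eqmP[e he].
  apply/val_inj/(eqm_small (ltn_ord u) (ltn_ord v))/eqmP; exists e.
  by move: he; rewrite exprS; lia.
congr #|pred_of_set _|; apply/setP => s; apply/imsetP/imsetP => [[[x y]]|[u]].
  rewrite inE /= => /and3P[_ _]; rewrite eqz_mod_dvd dvdE => /eqmP[e he] ->.
  move: (x : nat)%:Z (y : nat)%:Z he => {x y} x y he.
  (* The product is odd, so both factors are odd and their sum is even. *)
  have [v hv] : exists v, x + y = 2 * v.
    apply: even_intP; move: he; rewrite exprS => he.
    have [/even_intP[g hg]|ox] := boolP (2 %| x)%Z.
      by move: he; rewrite hg; lia.
    have [/even_intP[g hg]|oy] := boolP (2 %| y)%Z.
      by move: he; rewrite hg; lia.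
    by lia.
  have [i hi /eqmP[g hg]] := eqm_repr t v.
  exists (Ordinal hi).
    rewrite inE /=.
    apply/sqP.
    (* Every integer is a square mod 2; u^2 mod 2^(t+1) depends only on u mod 2^t
       when t > 0. *)
    have [->|t0] := eqVneq t 0%N.
      exists (i%:Z * i%:Z - a); apply/eqmP; set c := _ - _.
      exists ((c * c - c) %/ 2)%Z.
      have : (2 %| c * c - c)%Z.
        have [/even_intP[j ->]|/odd_intP[j ->]] := boolP (2 %| c)%Z; lia.
      by rewrite expr1; lia.
    exists (x - v); apply/eqmP.
    have yE : y = 2 * v - x by rewrite -hv; ring.
    have tE : 2 ^+ t = 2 * 2 ^+ t.-1 :> int by rewrite -exprS prednK ?lt0n.
    exists (g * i%:Z + g * g * 2 ^+ t.-1 - e).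
    have -> : (x - v) * (x - v) = v * v - x * y by rewrite yE; ring.
    by rewrite he hg exprS tE; ring.
  apply/eqP; rewrite intr_Zp_eq // dvdE hv hg; apply/eqmP; exists g.
  by rewrite exprS /=; ring.
rewrite inE => /sqP[z /eqmP[e he]] ->.
rewrite /f; move: (u : nat)%:Z he => {u} u he.
(* Conversely, a root [z] of [u * u - a] yields the pair [u + z], [u - z], reduced modulo
   [2 ^ t.+1]. *)
have [i hi /eqmP[g hg]] := eqm_repr t.+1 (u + z).
have [j hj /eqmP[h hh]] := eqm_repr t.+1 (u - z).
have ijE : eqm t.+1 (i%:Z * j%:Z) a.
  apply/eqmP; exists (- e - g * (u - z) - h * (u + z) + g * h * 2 ^+ t.+1).
  have -> : i%:Z = u + z - g * 2 ^+ t.+1 by rewrite hg; ring.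
  have -> : j%:Z = u - z - h * 2 ^+ t.+1 by rewrite hh; ring.
  have -> : a = u * u - z * z + e * 2 ^+ t.+1 by rewrite he; ring.
  ring.
(* The range in [H2] excludes 0; the odd product ensures this. *)
have [i0 j0] : i != 0%N /\ j != 0%N.
  case/eqmP: ijE => q; rewrite exprS => hq.
  by split; apply/eqP => ij0; move: hq; rewrite ij0; lia.
exists (Ordinal hi, Ordinal hj); rewrite ?inE /=.
  by rewrite !lt0n i0 j0 eqz_mod_dvd dvdE.
apply/eqP; rewrite intr_Zp_eq // dvdE; apply/eqmP; exists (g + h).
have -> : i%:Z = u + z - g * 2 ^+ t.+1 by rewrite hg; ring.
have -> : j%:Z = u - z - h * 2 ^+ t.+1 by rewrite hh; ring.
ring.
Qed.

(** * The formulas for large exponents, and the small moduli by evaluation *)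

Lemma S2bar_formula a t : ~~ (2 %| a)%Z -> (5 <= t)%N ->
  [/\ (a = 1 %[mod 8])%Z ->
        #|S2bar a (2 ^ t)%N|%:R
          = 2 ^+ (t - 4) / 3 + (-1) ^+ (t - 1) / 3 + 3 :> rat,
      (a = 3 %[mod 8])%Z \/ (a = 7 %[mod 8])%Z ->
        #|S2bar a (2 ^ t)%N| = (2 ^ (t - 3))%N
    & (a = 5 %[mod 8])%Z ->
        #|S2bar a (2 ^ t)%N| = (2 ^ (t - 4))%N].
Proof.
move=> oa t5; have [k ->] : exists k, t = (k + 4).+1 by exists (t - 5)%N; lia.
rewrite card_S2bar //; split=> ha.
- have -> : ((k + 4).+1 - 4 = k.+1)%N by lia.
  have -> : ((k + 4).+1 - 1 = k + 4)%N by lia.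
  have -> : (k + 4 = k.+1 + 3)%N by lia.
  rewrite -addnS cnt_1mod8; last by lia.
  have -> : (k.+1 + 3 = k.+4)%N by lia.
  (* Twice the closed form is [(2 ^+ k.+1 - (-1) ^+ k.+1 + 9) / 3], and
     [- (-1) ^+ k.+1 = (-1) ^+ (k + 4)]. *)
  by have := cnt_sq k; rewrite natrM !exprS; lra.
- have -> : (k + 4 = k.+2 + 2)%N by lia.
  have -> : ((k.+2 + 2).+1 = k.+2.+3)%N by lia.
  by rewrite cnt_3mod4; [congr (2 ^ _)%N; lia | lia].
- have e : ((k + 4).+1 = k.+4.+1)%N by lia.
  by rewrite e cnt_5mod8; [congr (2 ^ _)%N; lia | lia].
Qed.

(** Replacing [a] by a numeral [b] makes the count a closed term, which computation settles for
    small [t]. *)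
Lemma card_S2bar_eqm a b t : ~~ (2 %| a)%Z -> eqm t.+1 a b ->
  #|S2bar a (2 ^ t.+1)| = cnt t (fun u => sq t.+1 (u * u - b)).
Proof.
move=> oa /eqmP[e ab]; rewrite card_S2bar //; apply: eq_cnt => u.
by apply: sq_eqmE; apply/eqmP; exists (- e); rewrite ab; ring.
Qed.

Theorem theorem3p3 (a : int) (ha : ~~ (2 %| a)%Z) :
  (forall t : nat, (5 <= t)%N ->
     [/\ (a = 7 %[mod 8])%Z ->
           #|D2bar a (2 ^ t)%N|%:R
             = 2 ^+ (t - 4) / 3 + (-1) ^+ (t - 1) / 3 + 3 :> rat,
         (a = 1 %[mod 8])%Z \/ (a = 5 %[mod 8])%Z ->
           #|D2bar a (2 ^ t)%N| = (2 ^ (t - 3))%N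
       & (a = 3 %[mod 8])%Z ->
           #|D2bar a (2 ^ t)%N| = (2 ^ (t - 4))%N])
  /\ (forall t : nat, (5 <= t)%N ->
     [/\ (a = 1 %[mod 8])%Z ->
           #|S2bar a (2 ^ t)%N|%:R
             = 2 ^+ (t - 4) / 3 + (-1) ^+ (t - 1) / 3 + 3 :> rat,
         (a = 3 %[mod 8])%Z \/ (a = 7 %[mod 8])%Z ->
           #|S2bar a (2 ^ t)%N| = (2 ^ (t - 3))%N
       & (a = 5 %[mod 8])%Z ->
           #|S2bar a (2 ^ t)%N| = (2 ^ (t - 4))%N])
  /\ #|S2bar a 16| = 2%N
  /\ (forall t : nat, (1 <= t <= 3)%N ->
        ~ (t = 3%N /\ (a = 1 %[mod 4])%Z) ->
        #|S2bar a (2 ^ t)%N| = 1%N)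
  /\ ((a = 1 %[mod 4])%Z -> #|S2bar a 8| = 2%N).

split=> [t t5|].
  have n1 : (1 < 2 ^ t)%N by rewrite -{1}(expn0 2) ltn_exp2l //; lia.
  have oNa : ~~ (2 %| - a)%Z by lia.
  (* Negation modulo 8 exchanges 7 with 1 and 5 with 3, which matches the cases for differences with
     those for sums. *)
  have [h1 h37 h5] := S2bar_formula oNa t5.
  by rewrite D2bar_S2bar //; split=> h; [apply: h1 | apply: h37 | apply: h5]; lia.
split=> [t|]; first exact: S2bar_formula.
split.
  have : [|| eqm 4 a 1, eqm 4 a 3, eqm 4 a 5, eqm 4 a 7, eqm 4 a 9,
             eqm 4 a 11, eqm 4 a 13 | eqm 4 a 15].
    rewrite /eqm (_ : 2 ^+ 4 = 16) //; lia.
  do ?[case/orP]; move=> /(card_S2bar_eqm (t := 3) ha)->; by vm_compute.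
have S8 b : eqm 3 a b -> #|S2bar a 8| = cnt 2 (fun u => sq 3 (u * u - b)).
  exact: (card_S2bar_eqm (t := 2) ha).
split=> [[|[|[|[|t]]]] // _|].
- have : eqm 1 a 1 by rewrite /eqm expr1; lia.
  by move=> /(card_S2bar_eqm (t := 0) ha)->.
- have : eqm 2 a 1 || eqm 2 a 3 by rewrite /eqm (_ : 2 ^+ 2 = 4) //; lia.
  by case/orP=> /(card_S2bar_eqm (t := 1) ha)->.
(* The excluded class 1 mod 4 leaves only 3 and 7 modulo 8. *)
- move=> h3; have : eqm 3 a 3 || eqm 3 a 7.
    have : ~ (a = 1 %[mod 4])%Z by move=> h; apply: h3.
    by rewrite !eqm3; lia.
  by case/orP=> /S8.
- move=> h1; have : eqm 3 a 1 || eqm 3 a 5 by rewrite !eqm3; lia.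
  by case/orP=> /S8.
Qed.
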